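(* Let $D,r,Q$ be positive integers and $\epsilon>0$. There exists a positive integer $q=q(D,r,Q,\epsilon)$ such that the following holds for every $\delta\in(0,1]$. Let $P:\mathbb{Z}\to\mathbb{Z}^r$, $P(n)=(P_1(n),\dots,P_r(n))$ with $P_i\in\mathbb{Z}[n]$, $\deg P_i\le D$, have multiplicative complexity $Q$ and hyperplane-fleeing image. Let $T:\mathbb{Z}^r\curvearrowright(X,\mu)$ be an ergodic measure preserving action and $B\subset X$ be $(q,\delta)$-equidistributed. Then $$\limsup_{N\to\infty}\Big\|\mu(B)-\frac1N\sum_{n=1}^N T^{P(n)}\mathbb{1}_B\Big\|_2\le\sqrt{3\delta}+\epsilon.$$
   Context: $T^vf:=f\circ T^v$. A polynomial map $P$ has multiplicative complexity $Q$ if for all $\vec a\in\mathbb{Z}^r$, $q\in\mathbb{Z}$ with $\gcd(a_1,\dots,a_r,q)=1$, writing $(P(n)-P(0))\cdot\vec a=\sum_{j\ge1}b_jn^j$, one has $\gcd(b_1,\dots,b_D,q)\le Q$. A subset of $\mathbb{R}^r$ is hyperplane-fleeing if it is not contained in any proper affine subspace. With $F_n=[1,n]^r\cap\mathbb{Z}^r$, $B$ is $(q,\delta)$-equidistributed if for $\mu$-a.e. $x$, $\lim_{n\to\infty}\frac{1}{|F_n|}|\{a\in F_n:T^{qa}x\in B\}|\le(1+\delta)\mu(B)$. *)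

(* Defs.v *)
From HB Require Import structures.
From mathcomp Require Import all_boot all_order all_algebra.
From mathcomp Require Import all_classical all_reals all_analysis.
Set Implicit Arguments. Unset Strict Implicit. Unset Printing Implicit Defensive.
Import Order.TTheory GRing.Theory Num.Theory numFieldNormedType.Exports.
Local Open Scope classical_set_scope.
Local Open Scope ring_scope.

Definition polymap (r : nat) (P : 'I_r -> {poly int}) (n : int) : 'rV[int]_r :=
  \row_i (P i).[n].

Definition gcd_family (I : finType) (a : I -> int) : nat :=
  \big[gcdn/0%N]_(i : I) `|a i|%N.

Definition mult_complexity (D r : nat) (P : 'I_r -> {poly int}) (Q : nat) : Prop :=
  forall (a : 'I_r -> int) (q : int),
    gcdn (gcd_family a) `|q|%N = 1%N ->
    let b := \sum_(i < r) a i *: (P i - ((P i)`_0)%:P) in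
    (gcdn (\big[gcdn/0%N]_(1 <= j < D.+1) absz (b`_j)%R) `|q|%N <= Q)%N.

Definition hyperplane_fleeing (R : realType) (r : nat) (P : 'I_r -> {poly int}) : Prop :=
  ~ exists (x0 : 'rV[R]_r) (V : {vspace 'rV[R]_r}),
      V != fullv /\ forall n : int, map_mx intr (polymap P n) - x0 \in V.

Definition mp_action d (X : measurableType d) (R : realType)
    (mu : {measure set X -> \bar R}) (r : nat) (T : 'rV[int]_r -> X -> X) : Prop :=
  [/\ T 0 = id,
      forall u v, T (u + v) = T u \o T v,
      forall v, measurable_fun setT (T v) &
      forall v A, measurable A -> mu (T v @^-1` A) = mu A].

Definition ergodic_action d (X : measurableType d) (R : realType)
    (mu : {measure set X -> \bar R}) (r : nat) (T : 'rV[int]_r -> X -> X) : Prop :=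
  forall A, measurable A -> (forall v, T v @^-1` A = A) ->
    mu A = 0%E \/ mu A = 1%E.

Definition freq d (X : measurableType d) (R : realType) (r : nat)
    (T : 'rV[int]_r -> X -> X) (q : nat) (B : set X) (x : X) (n : nat) : R :=
  ((n%:R ^+ r)^-1 *
   \sum_(a : {ffun 'I_r -> 'I_n}) \1_B (T (\row_i ((q * (a i).+1)%N%:Z)) x))%R.

Definition equidistributed d (X : measurableType d) (R : realType)
    (mu : {measure set X -> \bar R}) (r : nat) (T : 'rV[int]_r -> X -> X)
    (q : nat) (delta : R) (B : set X) : Prop :=
  {ae mu, forall x, exists L : R,
     @freq d X R r T q B x @ \oo --> L /\ (L%:E <= (1 + delta)%:E * mu B)%E}.

(* the function mu(B) - (1/N) sum_{n=1}^N T^{P(n)} 1_B, where T^v f := f o T^v *)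
Definition ergavg d (X : measurableType d) (R : realType)
    (mu : {measure set X -> \bar R}) (r : nat) (T : 'rV[int]_r -> X -> X)
    (P : 'I_r -> {poly int}) (B : set X) (N : nat) (x : X) : R :=
  fine (mu B) - N%:R^-1 * \sum_(1 <= n < N.+1) \1_B (T (polymap P n%:Z) x).

(* Main.v *)
Require Import Defs.
From HB Require Import structures.
From mathcomp Require Import all_boot all_order all_algebra.
From mathcomp Require Import all_classical all_reals all_analysis.
From mathcomp Require Import measurable_realfun ring lra zify.
Set Implicit Arguments. Unset Strict Implicit. Unset Printing Implicit Defensive.
Import Order.TTheory GRing.Theory Num.Theory.
Local Open Scope classical_set_scope.
Local Open Scope ring_scope.

(** Let an abelian group act by linear isometries on a pre-Hilbert space, and let [p n]
be the sum of the [c j *+ n ^ j] for [j <= D]. By induction on [D], there is a [q]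
depending only on [D], [C] and [eps] such that the averages of the [p n]-translates of
a vector [f] with [`|f| <= C] are eventually at most [eps] in norm as soon as [f]
averages to 0 along the group generated by the [q c_j], [1 <= j <= D]. To see this,
split [f] into a part that is nearly invariant under the [q c_j] with [j >= 2] and a
part that averages to 0 along the group they generate. On the latter, van der Corput's
inequality with a bounded number of differences [p (n + k) - p (n + h)] reduces the
degree, and the group generated by the new coefficients contains the old [q c_j],
[j >= 2], for a suitable [q]. On the former, [p (n + q a)] acts nearly as
[p n + q a c_1], so its averages are controlled by the averages of [f] along the group.

For the theorem, the multiplicative complexity bound says that [Q`! Z^r] lies in the
lattice spanned by the coefficients of [P]. Let [f'] be the average of the indicator
function of [B] over a large box of [q Z^r]. Its difference with the indicator averages
to 0 along that lattice, while equidistribution bounds the square of the norm of [f']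
by about [(1 + delta) mu(B)^2], so that [f'] is close to the constant [mu(B)]. *)

(** * Means *)

Section Mean.
Context {R : numFieldType} {V : lmodType R}.

Definition mean (I : Type) (s : seq I) (x : I -> V) : V :=
  (size s)%:R^-1 *: \sum_(i <- s) x i.

Lemma eq_mean (I : Type) (s : seq I) (x y : I -> V) :
  x =1 y -> mean s x = mean s y.
Proof. by move=> /funext ->. Qed.

Lemma eq_in_mean (I : eqType) (s : seq I) (x y : I -> V) :
  {in s, x =1 y} -> mean s x = mean s y.
Proof. by move=> xy; rewrite /mean (eq_big_seq _ xy). Qed.

Lemma meanD (I : Type) (s : seq I) (x y : I -> V) :
  mean s (fun i => x i + y i) = mean s x + mean s y.
Proof. by rewrite /mean big_split/= scalerDr. Qed.

Lemma meanZ (I : Type) (s : seq I) a (x : I -> V) :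
  mean s (fun i => a *: x i) = a *: mean s x.
Proof. by rewrite /mean -scaler_sumr !scalerA mulrC. Qed.

Lemma meanB (I : Type) (s : seq I) (x y : I -> V) :
  mean s (fun i => x i - y i) = mean s x - mean s y.
Proof. by rewrite /mean sumrB scalerBr. Qed.

Lemma mean_cst (I : eqType) (s : seq I) (v : V) :
  s != [::] -> mean s (fun=> v) = v.
Proof.
rewrite -size_eq0 => s0; rewrite /mean big_const_seq count_predT iter_addr_0.
by rewrite -scaler_nat scalerA mulVf ?scale1r// pnatr_eq0.
Qed.

Lemma mean_exchange (I J : Type) (s : seq I) (t : seq J) (x : I -> J -> V) :
  mean s (fun i => mean t (x i)) = mean t (fun j => mean s (x^~ j)).
Proof. by rewrite /mean -!scaler_sumr !scalerA mulrC exchange_big. Qed.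

Lemma mean_map (I J : Type) (h : J -> I) (s : seq J) (x : I -> V) :
  mean (map h s) x = mean s (x \o h).
Proof. by rewrite /mean size_map big_map. Qed.

Lemma mean_iotaD (x : nat -> V) (s h N : nat) :
  mean (iota (s + h) N) x = mean (iota s N) (fun n => x (n + h)%N).
Proof.
by rewrite addnC iotaDl mean_map; apply: eq_mean => n /=; rewrite addnC.
Qed.

Lemma mean_allpairs (I J K : Type) (h : I -> J -> K) (s : seq I) (t : seq J)
    (x : K -> V) :
  mean [seq h i j | i <- s, j <- t] x = mean s (fun i => mean t (x \o h i)).
Proof.
by rewrite /mean size_allpairs natrM invfM big_allpairs_dep -scaler_sumr scalerA.
Qed.

End Mean.

Lemma linear_mean (R : numFieldType) (V W : lmodType R) (f : {linear V -> W})
    (I : Type) (s : seq I) (x : I -> V) :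
  f (mean s x) = mean s (f \o x).
Proof. by rewrite /mean linearZ linear_sum. Qed.

Lemma ler_mean (R : numFieldType) (I : eqType) (s : seq I) (x y : I -> R^o) :
  {in s, forall i, x i <= y i} -> mean s x <= mean s y.
Proof.
move=> xy; rewrite ler_wpM2l ?invr_ge0// big_seq [leRHS]big_seq.
exact: ler_sum.
Qed.

Lemma mean_le (R : numFieldType) (I : eqType) (s : seq I) (x : I -> R^o) (C : R) :
  0 <= C -> {in s, forall i, x i <= C} -> mean s x <= C.
Proof.
move=> C0 xC; have [->|s0] := eqVneq s [::]; first by rewrite /mean/= invr0 scale0r.
by rewrite -[leRHS](@mean_cst _ R^o _ s)//; exact: ler_mean.
Qed.

Lemma norm_sum_le (R : numDomainType) (V : semiNormedZmodType R) (I : Type)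
    (s : seq I) (x : I -> V) (C : R) :
  (forall i, `|x i| <= C) -> `|\sum_(i <- s) x i| <= (size s)%:R * C.
Proof.
move=> xC; rewrite (le_trans (ler_norm_sum _ _ _))// mulr_natl.
by rewrite -iter_addr_0 -[X in iter X]count_predT -big_const_seq; exact: ler_sum.
Qed.

(** * Pre-Hilbert spaces *)

(* The form need not be definite: square integrable functions are not identified when
   they agree almost everywhere. *)
HB.mixin Record isPreHilbert (R : realFieldType) V & GRing.Lmodule R V := {
  dot : V -> V -> R;
  dotC : forall x y, dot x y = dot y x;
  dot_scalar : forall y, scalar (dot^~ y);
  dot_ge0 : forall x, 0 <= dot x x }.

#[short(type=preHilbertType)]
HB.structure Definition PreHilbert (R : realFieldType) :=
  {V of isPreHilbert R V & GRing.Lmodule R V}.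

Section PreHilbertNorm.
Variables (R : rcfType) (V : preHilbertType R).
Implicit Types x y : V.

Fact dot_biscalar : bilinear_for *%R *%R (@dot R V).
Proof. by split => x a y z; rewrite ?dot_scalar// !(dotC x) dot_scalar. Qed.

HB.instance Definition _ := bilinear_isBilinear.Build R V V R *%R *%R (@dot R V)
  dot_biscalar.

Definition hnorm x := Num.sqrt (dot x x).

Lemma dotD x y : dot (x + y) (x + y) = dot x x + 2 * dot x y + dot y y.
Proof. by rewrite linearDl !linearDr/= (dotC y x); ring. Qed.

Lemma dot_le_hnorm x y : dot x y <= hnorm x * hnorm y.
Proof.
rewrite -sqrtrM ?dot_ge0// (le_trans (ler_norm _))// -sqrtr_sqr ler_wsqrtr//.
have := @deg_le2_poly_ge0 _ (\poly_(i < 3) [:: dot x x; 2 * dot x y; dot y y]`_i).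
rewrite !coef_poly/= exprMn => h.
suff : 2 ^+ 2 * dot x y ^+ 2 - 4 * dot y y * dot x x <= 0 by lra.
apply: h => [|t]; first exact: size_poly.
rewrite horner_poly !big_ord_recr big_ord0/= add0r expr0 expr1.
have := dot_ge0 (x + t *: y).
rewrite dotD !linearZr_LR !linearZl_LR/= /GRing.scale/=; lra.
Qed.

Lemma hnormD x y : hnorm (x + y) <= hnorm x + hnorm y.
Proof.
rewrite -(@ler_pXn2r _ 2) ?nnegrE ?addr_ge0 ?sqrtr_ge0//.
rewrite sqr_sqrtr ?dot_ge0// dotD sqrrD !sqr_sqrtr ?dot_ge0//.
by have := dot_le_hnorm x y; lra.
Qed.

Lemma hnormZ a x : hnorm (a *: x) = `|a| * hnorm x.
Proof.
by rewrite /hnorm linearZl_LR linearZr_LR/= mulrA -expr2 sqrtrM ?sqr_ge0 ?sqrtr_sqr.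
Qed.

Lemma hnormMn x n : hnorm (x *+ n) = hnorm x *+ n.
Proof. by rewrite -scaler_nat hnormZ normr_nat mulr_natl. Qed.

Lemma hnormN x : hnorm (- x) = hnorm x.
Proof. by rewrite -scaleN1r hnormZ normrN1 mul1r. Qed.

End PreHilbertNorm.

HB.instance Definition _ (R : rcfType) (V : preHilbertType R) :=
  Num.Zmodule_isSemiNormed.Build R V (@hnormD R V) (@hnormMn R V) (@hnormN R V).

Section PreHilbertTheory.
Variables (R : rcfType) (V : preHilbertType R).
Implicit Types x y : V.

Lemma cauchy_schwarz x y : dot x y <= `|x| * `|y|.
Proof. exact: dot_le_hnorm. Qed.

Lemma normr_sqr x : `|x| ^+ 2 = dot x x.
Proof. by rewrite sqr_sqrtr// dot_ge0. Qed.

Lemma normrD_sqr x y : `|x + y| ^+ 2 = `|x| ^+ 2 + 2 * dot x y + `|y| ^+ 2.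
Proof. by rewrite !normr_sqr dotD. Qed.

Lemma normrB_sqr x y : `|x - y| ^+ 2 = `|x| ^+ 2 - 2 * dot x y + `|y| ^+ 2.
Proof. by rewrite normrD_sqr normrN linearNr mulrN. Qed.

Lemma prehilbert_normrZ a x : `|a *: x| = `|a| * `|x|.
Proof. exact: hnormZ. Qed.

Lemma norm_mean_le (I : eqType) (s : seq I) (x : I -> V) (C : R) :
  0 <= C -> {in s, forall i, `|x i| <= C} -> `|mean s x| <= C.
Proof.
move=> C0 xC; rewrite (le_trans _ (mean_le C0 xC))// prehilbert_normrZ.
by rewrite ger0_norm ?invr_ge0// ler_wpM2l ?invr_ge0// ler_norm_sum.
Qed.

Lemma dot_meanl (I : Type) (s : seq I) (x : I -> V) y :
  dot (mean s x) y = mean s (fun i => dot (x i) y : R^o).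
Proof. by rewrite /mean linearZl_LR linear_sumlz. Qed.

Lemma dot_meanr (I : Type) (s : seq I) (x : I -> V) y :
  dot y (mean s x) = mean s (fun i => dot y (x i) : R^o).
Proof. by rewrite /mean linearZr_LR linear_sumr. Qed.

Lemma norm_mean_sqr (I : Type) (s : seq I) (x : I -> V) :
  `|mean s x| ^+ 2 =
    mean s (fun i => mean s (fun j => dot (x i) (x j) : R^o)).
Proof.
by rewrite normr_sqr dot_meanl; under eq_mean do rewrite dot_meanr.
Qed.

Lemma norm_mean_sqr_le (I : eqType) (s : seq I) (x : I -> V) :
  `|mean s x| ^+ 2 <= mean s (fun i => `|x i| ^+ 2 : R^o).
Proof.
have [->|s0] := eqVneq s [::].
  by rewrite /mean/= invr0 !scale0r normr0 expr0n.
have : 0 <= mean s (fun i => `|x i - mean s x| ^+ 2 : R^o).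
  by rewrite mulr_ge0 ?invr_ge0 ?sumr_ge0// => i _; exact: sqr_ge0.
under eq_mean => i do rewrite normrB_sqr -[2 * _]/(2 *: (_ : R^o)).
by rewrite meanD meanB meanZ mean_cst// -dot_meanl -normr_sqr /GRing.scale/=; lra.
Qed.

End PreHilbertTheory.

Section MeanShift.
Variables (R : realType) (V : preHilbertType R).
Implicit Types x : nat -> V.

Lemma norm_mean_shift_le x (s h N : nat) (C : R) : (forall n, `|x n| <= C) ->
  `|mean (iota s N) x - mean (iota (s + h) N) x| <= 2 * C * h%:R / N%:R.
Proof.
move=> xC; rewrite /mean !size_iota -scalerBr prehilbert_normrZ.
rewrite ger0_norm ?invr_ge0// mulrC ler_wpM2r ?invr_ge0//.
have -> : \sum_(n <- iota s N) x n - \sum_(n <- iota (s + h) N) x n =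
    \sum_(n <- iota s h) x n - \sum_(n <- iota (s + N) h) x n.
  apply/eqP; rewrite subr_eq addrAC eq_sym subr_eq -!big_cat -!iotaD/=.
  by rewrite addnC.
have sumC k : `|\sum_(n <- iota k h) x n| <= C * h%:R.
  by rewrite mulrC -[X in X%:R](size_iota k h) norm_sum_le.
by rewrite (le_trans (ler_normB _ _))// -mulrA mulr_natl mulr2n lerD.
Qed.

Lemma near_mean_shift_mean x (s : nat) (t : seq nat) (C tau : R) :
  (forall n, `|x n| <= C) -> t != [::] -> 0 < tau ->
  \forall N \near \oo,
    `|mean (iota s N) x - mean t (fun m => mean (iota (s + m) N) x)| <= tau.
Proof.
move=> xC t0 tau0; have C0 : 0 <= C := le_trans (normr_ge0 _) (xC 0%N).
pose M := (\max_(m <- t) m)%N; near=> N.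
rewrite -{1}(mean_cst (mean (iota s N) x) t0) -meanB.
apply: norm_mean_le => [|m mt]; first exact: ltW.
have N0 : 0 < N%:R :> R by rewrite ltr0n; near: N; exists 1%N.
rewrite (le_trans (norm_mean_shift_le s m N xC))// ler_pdivrMr//.
rewrite -ler_pdivrMl// (@le_trans _ _ (tau^-1 * (2 * C * M%:R)))//.
  rewrite ler_pM2l ?invr_gt0//; apply: ler_wpM2l; first exact: mulr_ge0.
  by rewrite ler_nat; apply: leq_bigmax_seq.
by near: N; exact: nbhs_infty_ger.
Unshelve. all: by end_near. Qed.

End MeanShift.

Section VanDerCorput.
Variables (R : realType) (V : preHilbertType R).

Lemma norm_mean_mean_sqr_le (I J : eqType) (s : seq I) (t : seq J)
    (x : I -> J -> V) :
  `|mean s (fun n => mean t (x n))| ^+ 2 <=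
    mean t (fun h => mean t (fun k => mean s (fun n => dot (x n h) (x n k) : R^o))).
Proof.
rewrite (le_trans (norm_mean_sqr_le _ _))//.
under eq_mean do rewrite norm_mean_sqr.
by rewrite mean_exchange; under eq_mean do rewrite mean_exchange.
Qed.

Lemma mean_kronecker (I : eqType) (t : seq I) h (a b : R) :
  uniq t -> h \in t ->
  mean t (fun k => (h == k)%:R * a + b : R^o) = (size t)%:R^-1 * a + b.
Proof.
move=> ut ht; rewrite meanD mean_cst; last by apply: contraTneq ht => ->.
congr (_ * _ + _); rewrite (bigD1_seq h)//= eqxx mul1r big1 ?addr0// => k.
by rewrite eq_sym => /negPf ->; rewrite mul0r.
Qed.

Lemma van_der_corput (x : nat -> V) (s H : nat) (C eta : R) :
  (0 < H)%N -> 0 <= eta -> (forall n, `|x n| <= C) ->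
  (forall h k, (h < k < H)%N -> \forall N \near \oo,
     mean (iota s N) (fun n => dot (x (n + k)%N) (x (n + h)%N) : R^o) <= eta) ->
  forall tau : R, 0 < tau -> \forall N \near \oo,
    `|mean (iota s N) x| <= Num.sqrt (C ^+ 2 / H%:R + eta) + tau.
Proof.
move=> H0 eta0 xC corr tau tau0; have C0 : 0 <= C := le_trans (normr_ge0 _) (xC 0%N).
have t0 : iota 0 H != [::] by rewrite -size_eq0 size_iota -lt0n.
pose c N h k : R^o := mean (iota s N) (fun n => dot (x (n + h)%N) (x (n + k)%N)).
have cC N h k : c N h k = c N k h by rewrite /c; under eq_mean do rewrite dotC.
have corr_lt : \forall N \near \oo, forall hk : 'I_H * 'I_H,
    (hk.1 < hk.2)%N -> c N hk.2 hk.1 <= eta.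
  apply: filter_forall => -[h k]/=; have [hk|_] := ltnP h k; last by near=> N.
  have hkH : (h < k < H)%N by rewrite hk ltn_ord.
  by apply: filterS (corr _ _ hkH) => N.
near=> N.
have corrN : forall hk : 'I_H * 'I_H, (hk.1 < hk.2)%N -> c N hk.2 hk.1 <= eta.
  by near: N.
have cN h k : h \in iota 0 H -> k \in iota 0 H ->
    c N h k <= (h == k)%:R * C ^+ 2 + eta.
  rewrite !mem_iota/= => hH kH; have [hk|kh|->] := ltngtP h k.
  - by rewrite mul0r add0r cC (corrN (Ordinal hH, Ordinal kH)).
  - by rewrite mul0r add0r (corrN (Ordinal kH, Ordinal hH)).
  - rewrite mul1r ler_wpDr//; apply: mean_le => [|n _]; first exact: sqr_ge0.
    by rewrite -normr_sqr lerXn2r ?nnegrE.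
rewrite -[mean _ x](subrK (mean (iota 0 H) (fun m => mean (iota (s + m) N) x))).
rewrite (le_trans (ler_normD _ _))// addrC lerD//; last first.
  by near: N; exact: near_mean_shift_mean.
under eq_mean do rewrite mean_iotaD.
rewrite -[leLHS]ger0_norm// -sqrtr_sqr ler_wsqrtr// mean_exchange.
rewrite (le_trans (norm_mean_mean_sqr_le _ _ _))//.
apply: mean_le => [|h hH]; first by rewrite addr_ge0// divr_ge0// sqr_ge0.
rewrite [C ^+ 2 / _]mulrC -[X in X%:R](size_iota 0 H).
rewrite -(mean_kronecker _ _ (iota_uniq 0 H) hH).
by apply: ler_mean => k kH; exact: cN.
Unshelve. all: by end_near. Qed.

End VanDerCorput.

(** * Isometric actions *)

Record isometric_action (R : rcfType) (V : preHilbertType R) (G : zmodType)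
    (U : G -> {linear V -> V}) : Prop := IsometricAction {
  act0 : forall x, U 0 x = x;
  actD : forall u v x, U (u + v) x = U u (U v x);
  norm_act : forall u x, `|U u x| = `|x| }.

Definition drawn_from (G : zmodType) (L : {pred G}) (s : seq G) : bool :=
  (s != [::]) && all [in L] s.

Section OrbitMean.
Variables (R : rcfType) (V : preHilbertType R) (G : zmodType).
Variable U : G -> {linear V -> V}.

Definition orbit_mean (s : seq G) (f : V) : V := mean s (fun v => U v f).

Fact orbit_mean_linear s : linear (orbit_mean s).
Proof.
move=> a f g; rewrite /orbit_mean -meanZ -meanD.
by apply: eq_mean => v; rewrite linearP.
Qed.

HB.instance Definition _ s :=
  GRing.isLinear.Build R V V *:%R (orbit_mean s) (orbit_mean_linear s).

(* In a Hilbert space: the projection of [f] to the [L]-invariant vectors is 0. *)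
Definition null (L : {pred G}) (f : V) : Prop := forall tau : R, 0 < tau ->
  exists2 s, drawn_from L s & `|orbit_mean s f| <= tau.

End OrbitMean.

Section IsometricAction.
Variables (R : realType) (V : preHilbertType R) (G : zmodType).
Variable U : G -> {linear V -> V}.
Hypothesis isoU : isometric_action U.
Implicit Types (L : zmodClosed G) (s t : seq G) (f g : V).
Local Notation orbit_mean := (orbit_mean U).
Local Notation null := (null U).

Lemma actC u v f : U u (U v f) = U v (U u f).
Proof. by rewrite -!(actD isoU) addrC. Qed.

Lemma dot_act u f g : dot (U u f) (U u g) = dot f g.
Proof.
have := norm_act isoU u (f + g); rewrite linearD => /(congr1 (fun a => a ^+ 2)).
by rewrite !normrD_sqr !(norm_act isoU); lra.
Qed.

Lemma norm_mean_act_le (I : eqType) (s : seq I) (p : I -> G) f :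
  `|mean s (fun i => U (p i) f)| <= `|f|.
Proof. by apply: norm_mean_le => // i _; rewrite (norm_act isoU). Qed.

Lemma norm_orbit_mean s f : `|orbit_mean s f| <= `|f|.
Proof. exact: norm_mean_act_le. Qed.

Lemma norm_sub_orbit_mean s f : `|f - orbit_mean s f| <= 2 * `|f|.
Proof.
by rewrite (le_trans (ler_normB _ _))// mulr_natl mulr2n lerD2l norm_orbit_mean.
Qed.

Lemma norm_mean_act_split (I : Type) (s : seq I) (p : I -> G) f g :
  `|mean s (fun i => U (p i) f)| <=
    `|mean s (fun i => U (p i) (f - g))| + `|mean s (fun i => U (p i) g)|.
Proof.
by rewrite -{1}(subrK g f); under eq_mean do rewrite linearD; rewrite meanD ler_normD.
Qed.

Lemma norm_mean_act_sub_invariant (I : eqType) (s : seq I) (p : I -> G) f g h :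
  s != [::] -> (forall v, U v h = h) ->
  `|mean s (fun i => U (p i) f) - h| <=
    `|mean s (fun i => U (p i) (f - g))| + `|g - h|.
Proof.
move=> s0 hU; rewrite -{1}(mean_cst h s0) -meanB.
under eq_mean => i do rewrite -{1}(hU (p i)) -linearB.
rewrite (le_trans (norm_mean_act_split _ _ _ (g - h)))// opprB addrA subrK.
by rewrite lerD2l norm_mean_act_le.
Qed.

Lemma act_orbit_mean u s f : U u (orbit_mean s f) = orbit_mean s (U u f).
Proof. by rewrite linear_mean; apply: eq_mean => v; exact: actC. Qed.

Lemma orbit_mean_comp s t f :
  orbit_mean s (orbit_mean t f) = orbit_mean [seq u + v | u <- s, v <- t] f.
Proof.
rewrite [RHS]mean_allpairs; apply: eq_mean => u; rewrite linear_mean.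
by apply: eq_mean => v /=; rewrite (actD isoU).
Qed.

Lemma orbit_meanC s t f :
  orbit_mean s (orbit_mean t f) = orbit_mean t (orbit_mean s f).
Proof. by rewrite [RHS]linear_mean; apply: eq_mean => v; rewrite /= act_orbit_mean. Qed.

Lemma drawn_from_allpairs L s t : drawn_from L s -> drawn_from L t ->
  drawn_from L [seq u + v | u <- s, v <- t].
Proof.
rewrite /drawn_from -!size_eq0 size_allpairs muln_eq0 negb_or.
move=> /andP[-> /allP sL] /andP[-> /allP tL].
apply/allP => _ /allpairsP[[u v] [us vt ->]].
exact: rpredD (sL _ us) (tL _ vt).
Qed.

Lemma drawn_from1 L v : v \in L -> drawn_from L [:: v].
Proof. by move=> Lv; rewrite /drawn_from/= Lv. Qed.

Lemma null_sub (L L' : {pred G}) f : {subset L <= L'} -> null L f -> null L' f.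
Proof.
move=> LL' nf tau /nf[s /andP[s0 /allP sL] fs]; exists s => //.
by rewrite /drawn_from s0; apply/allP => v /sL /LL'.
Qed.

Lemma nullD L f g : null L f -> null L g -> null L (f + g).
Proof.
move=> nf ng tau tau0; have tau20 : 0 < tau / 2 by rewrite divr_gt0.
have [s sL fs] := nf _ tau20; have [t tL gt] := ng _ tau20.
exists [seq u + v | u <- s, v <- t]; first exact: drawn_from_allpairs.
rewrite -orbit_mean_comp !linearD/= (le_trans (ler_normD _ _))// [tau]splitr lerD//.
  by rewrite orbit_meanC (le_trans (norm_orbit_mean _ _)).
by rewrite (le_trans (norm_orbit_mean _ _)).
Qed.

Lemma nullZ (L : {pred G}) a f : null L f -> null L (a *: f).
Proof.
move=> nf tau tau0; have a0 : 0 < `|a| + 1 by rewrite ltr_wpDl.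
have [s sL fs] := nf _ (divr_gt0 tau0 a0); exists s => //.
rewrite linearZ/= prehilbert_normrZ (le_trans (ler_wpM2l _ fs))//.
by rewrite mulrA ler_pdivrMr// mulrC ler_pM2l// lerDl.
Qed.

Lemma null0 L : null L 0.
Proof.
move=> tau tau0; exists [:: 0]; first by rewrite drawn_from1 ?rpred0.
by rewrite linear0 normr0 ltW.
Qed.

Lemma null_mean (I : eqType) (r : seq I) (x : I -> V) L :
  {in r, forall i, null L (x i)} -> null L (mean r x).
Proof.
move=> xL; apply: nullZ; rewrite big_seq.
by elim/big_ind : _ => [|f g|]; [exact: null0|exact: nullD|exact: xL].
Qed.

Lemma null_act (L : {pred G}) v f : null L f -> null L (U v f).
Proof.
move=> nf tau /nf[s sL fs]; exists s => //.
by rewrite -act_orbit_mean (norm_act isoU).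
Qed.

Lemma null_orbit_mean L s f : null L f -> null L (orbit_mean s f).
Proof. by move=> nf; apply: null_mean => v _; exact: null_act. Qed.

Lemma null_coboundary L v f : v \in L -> null L (f - U v f).
Proof.
move=> Lv tau tau0; pose n := (Num.truncn (2 * `|f| / tau)).+1.
exists [seq v *+ i | i <- iota 0 n].
  by apply/andP; split => //; apply/allP => _ /mapP[i _ ->]; rewrite rpredMn.
have -> : orbit_mean [seq v *+ i | i <- iota 0 n] (f - U v f) =
    n%:R^-1 *: (f - U (v *+ n) f).
  rewrite [LHS]mean_map /mean size_iota -[iota 0 n]/(index_iota 0 n).
  under eq_bigr => i _ do rewrite /= linearB -(actD isoU) -mulrSr -opprB.
  by rewrite sumrN telescope_sumr// opprB mulr0n (act0 isoU).
rewrite prehilbert_normrZ ger0_norm ?invr_ge0// ler_pdivrMl//.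
rewrite (le_trans (ler_normB _ _))// (norm_act isoU).
have : 2 * `|f| / tau <= n%:R by rewrite ltW// truncnS_gt.
by rewrite ler_pdivrMr//; lra.
Qed.

Lemma null_sub_orbit_mean L s f : drawn_from L s -> null L (f - orbit_mean s f).
Proof.
move=> /andP[s0 /allP sL]; rewrite -{1}(mean_cst f s0) -meanB.
by apply: null_mean => v /sL; exact: null_coboundary.
Qed.

Lemma null_trivial (L : {pred G}) f :
  (forall v, v \in L -> v = 0) -> null L f -> `|f| = 0.
Proof.
move=> L0 nf; apply/eqP; rewrite eq_le normr_ge0 andbT; apply/ler_addgt0Pl => tau tau0.
have [s /andP[s0 /allP sL]] := nf _ tau0.
have -> : orbit_mean s f = f; last by rewrite addr0.
rewrite -[RHS](mean_cst f s0); apply: eq_in_mean => v /sL/L0 ->.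
exact: act0 isoU _.
Qed.

Lemma dot_orbit_mean_invariant s f g : s != [::] -> (forall v, U v g = g) ->
  dot (orbit_mean s f) g = dot f g.
Proof.
move=> s0 gU; rewrite dot_meanl -[RHS](@mean_cst _ R^o _ s)//.
by apply: eq_mean => v; rewrite -{1}(gU v) dot_act.
Qed.

(* The orbit mean of nearly minimal norm is nearly invariant by the parallelogram
   law, since its midpoint with a translate is again an orbit mean. *)
Lemma almost_invariant_orbit_mean L f (tau : R) : 0 < tau ->
  exists2 s, drawn_from L s &
    {in L, forall v, `|U v (orbit_mean s f) - orbit_mean s f| <= tau}.
Proof.
move=> tau0; pose E := [set `|orbit_mean t f| ^+ 2 | t in [set t | drawn_from L t]].
have infE : has_inf E.
  split; last by exists 0 => _ [t _ <-]; exact: sqr_ge0.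
  by exists (`|orbit_mean [:: 0] f| ^+ 2), [:: 0] => //; exact/drawn_from1/rpred0.
have tau2 : 0 < tau ^+ 2 / 4 by rewrite divr_gt0// exprn_gt0.
have [_ [s sL <-] s_min] := inf_adherent tau2 infE; exists s => // v Lv.
set g := orbit_mean s f; rewrite -(@ler_pXn2r _ 2) ?nnegrE ?(ltW tau0)//.
have vsL : drawn_from L [seq u + w | u <- [:: 0; v], w <- s].
  by apply: drawn_from_allpairs => //; rewrite /drawn_from/= rpred0 Lv.
have midpoint : `|orbit_mean [:: 0; v] g| ^+ 2 = 2^-1 ^+ 2 * `|U v g + g| ^+ 2.
  rewrite {1}/orbit_mean /mean !big_cons big_nil addr0 (act0 isoU) addrC.
  by rewrite prehilbert_normrZ ger0_norm ?invr_ge0// exprMn.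
have : inf E <= `|orbit_mean [:: 0; v] g| ^+ 2.
  apply: ge_inf; first exact: infE.2.
  by rewrite orbit_mean_comp; exists [seq u + w | u <- [:: 0; v], w <- s].
move: s_min; rewrite -/g midpoint normrB_sqr normrD_sqr (norm_act isoU); lra.
Qed.

End IsometricAction.

(** * Polynomial averages *)

Section GroupValuedPolynomials.
Variable G : zmodType.
Implicit Types (x c : nat -> G) (L : zmodClosed G).

Definition zspan (a b : nat) x : {pred G} :=
  [pred v | `[< exists k : nat -> int, v = \sum_(a <= j < b) x j *~ k j >]].

Fact zspan_zmod_closed a b x : zmod_closed (zspan a b x).
Proof.
split=> [|u v /asboolP[k ->] /asboolP[l ->]]; apply/asboolP.
  by exists (fun=> 0); rewrite big1.
by exists (fun j => k j - l j); rewrite -sumrB; apply: eq_bigr => j _; rewrite mulrzBr.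
Qed.

HB.instance Definition _ a b x :=
  GRing.isZmodClosed.Build G (zspan a b x) (zspan_zmod_closed a b x).

Lemma mem_zspan a b x j : (a <= j < b)%N -> x j \in zspan a b x.
Proof.
move=> ajb; apply/asboolP; exists (fun i => (i == j)%:Z).
rewrite (bigD1_seq j) ?iota_uniq ?mem_index_iota//= eqxx big1 ?addr0// => i.
by move=> /negPf ->; rewrite mulr0z.
Qed.

Lemma zspan_min a b x L : (forall j, (a <= j < b)%N -> x j \in L) ->
  {subset zspan a b x <= L}.
Proof.
move=> xL _ /asboolP[k ->]; rewrite big_nat rpred_sum// => j ajb.
by rewrite rpredMz ?xL.
Qed.

Lemma zspan_recl a b x v : (a < b)%N -> v \in zspan a b x ->
  exists m : int, v - x a *~ m \in zspan a.+1 b x.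
Proof.
move=> ab /asboolP[k ->]; exists (k a); apply/asboolP; exists k.
by rewrite big_ltn// addrC addKr.
Qed.

Definition zpoly c (D m : nat) : G := \sum_(0 <= j < D.+1) c j *+ (m ^ j).

Definition diff_coef c (D k i : nat) : G :=
  \sum_(i.+1 <= j < D.+2) c j *+ ('C(j, i) * k ^ (j - i)).

Lemma zpoly_diff c D m k :
  zpoly c D.+1 (m + k) = zpoly c D.+1 m + zpoly (diff_coef c D k) D m.
Proof.
rewrite /zpoly.
under [in X in _ + X]eq_bigr do rewrite -sumrMnl (big_nat_widenl _ 0)//.
rewrite (exchange_big_dep_nat predT)//= -big_split/=; apply: eq_big_nat => j jD.
rewrite addnC expnDn big_ord_recr/= subnn expn0 mul1n binn mul1n addnC mulrnDr.
congr (_ + _); rewrite -sumrMnr.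
rewrite -(big_mkord xpredT (fun i => c j *+ ('C(j, i) * (k ^ (j - i) * m ^ i)))).
rewrite (big_nat_widen _ _ D.+1); last by lia.
by apply: eq_big => // i _; rewrite -mulrnA mulnA.
Qed.

Lemma zpoly_shift q c D m a :
  zpoly c D.+1 (m + q * a) - zpoly c D.+1 m - c 1%N *+ (q * a)
    \in zspan 2 D.+2 (fun j => c j *+ q).
Proof.
rewrite /zpoly -sumrB big_ltn// big_ltn// !expn0 subrr add0r !expn1 mulrnDr.
rewrite (addrC (c 1%N *+ m)) addrK addrAC subrr add0r big_nat.
rewrite rpred_sum// => j jD.
rewrite -mulrnBr ?leq_exp2r ?leq_addr//; last by lia.
by rewrite subn_exp addKn -mulnA mulrnA rpredMn// (mem_zspan (fun j => c j *+ q)).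
Qed.

Lemma diff_coef_recl c D k i : (i <= D)%N ->
  diff_coef c D k i = c i.+1 *+ (i.+1 * k) +
    \sum_(i.+2 <= j < D.+2) c j *+ ('C(j, i) * k ^ (j - i)).
Proof. by move=> iD; rewrite /diff_coef big_ltn// binSn subSnn expn1. Qed.

(* The system expressing the new coefficients by the old ones is triangular, so it
   is solved from the leading coefficient down, losing a factor [M] at each step. *)
Lemma zspan_diff_coef q c D k M :
  (forall j, (2 <= j < D.+2)%N -> (j * k %| M)%N) ->
  {subset zspan 2 D.+2 (fun j => c j *+ (q * M ^ D)) <=
          zspan 1 D.+1 (fun j => diff_coef c D k j *+ q)}.
Proof.
move=> jkM; set L := zspan 1 _ _.
suff cL e j : (2 <= j < D.+2)%N -> (D.+2 <= j + e)%N -> c j *+ (q * M ^ e) \in L.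
  by apply: zspan_min => j jD; apply: cL => //; lia.
elim: e j => [|e IH] [//|i] iD ie; first by lia.
have /dvdnP[t tE] := jkM _ iD.
have diff_in : diff_coef c D k i *+ q \in L.
  by apply: (mem_zspan (fun j => diff_coef c D k j *+ q)); lia.
pose higher := \sum_(i.+2 <= j < D.+2) c j *+ ('C(j, i) * k ^ (j - i)).
have higher_in : higher *+ (q * M ^ e) \in L.
  rewrite /higher -sumrMnl big_nat rpred_sum// => j jD.
  by rewrite mulrnAC rpredMn// IH//; lia.
have leadE : c i.+1 *+ (i.+1 * k) = diff_coef c D k i - higher.
  by rewrite diff_coef_recl ?addrK//; lia.
have -> : c i.+1 *+ (q * M ^ e.+1) =
    diff_coef c D k i *+ q *+ (M ^ e * t) - higher *+ (q * M ^ e) *+ t.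
  rewrite -!mulrnA mulnA -mulrnBl -leadE -mulrnA expnS {1}tE; congr (_ *+ _).
  by ring.
by rewrite rpredB// rpredMn.
Qed.

End GroupValuedPolynomials.

Section AlmostInvariant.
Variables (R : realType) (V : preHilbertType R) (G : zmodType).
Variable U : G -> {linear V -> V}.
Hypothesis isoU : isometric_action U.

Lemma norm_act_sub u v (f : V) : `|U u f - U v f| = `|U (u - v) f - f|.
Proof.
by rewrite -{1}(subrK v u) [_ + v]addrC (actD isoU) -linearB (norm_act isoU).
Qed.

Lemma null_almost_invariant_multiples (a b : nat) (x : nat -> G) (f : V) (tau : R) :
  (a < b)%N -> 0 < tau -> {in zspan a.+1 b x, forall v, `|U v f - f| <= tau} ->
  null U (zspan a b x) f ->
  exists2 s : seq nat, s != [::] & `|mean s (fun m => U (x a *+ m) f)| <= 2 * tau.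
Proof.
move=> ab tau0 finv nf; have [t /andP[t0 /allP tL] ft] := nf _ tau0.
have /choice[m mP] v : exists m, v \in t -> v - x a *~ m \in zspan a.+1 b x.
  have [/tL/(zspan_recl ab)[m vm]|_] := boolP (v \in t); last by exists 0.
  by exists m.
pose M := (\max_(v <- t) `|m v|)%N; pose e v := absz (m v + M%:Z).
have eE v : v \in t -> x a *+ e v = x a *+ M + x a *~ m v.
  move=> vt; have mM : (`|m v| <= M)%N by apply: leq_bigmax_seq.
  by rewrite !pmulrn -mulrzDr; congr (_ *~ _); rewrite /e; lia.
exists (map e t); first by rewrite -size_eq0 size_map size_eq0.
rewrite mean_map -[mean t _](subrK (U (x a *+ M) (orbit_mean U t f))).
rewrite (le_trans (ler_normD _ _))// mulr_natl mulr2n lerD ?(norm_act isoU)//.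
rewrite linear_mean -meanB; apply: norm_mean_le => [|v vt]; first exact: ltW.
rewrite /= eE// (actD isoU) -linearB (norm_act isoU) distrC norm_act_sub.
exact/finv/mP.
Qed.

(* Modulo the near-invariance, shifting the argument of the polynomial by multiples
   of [q] acts as [c 1], so the polynomial average is dominated by linear ones. *)
Lemma near_mean_zpoly_almost_invariant (c : nat -> G) D q s (f : V) (tau : R) :
  0 < tau ->
  {in zspan 2 D.+2 (fun j => c j *+ q), forall v, `|U v f - f| <= tau} ->
  null U (zspan 1 D.+2 (fun j => c j *+ q)) f ->
  \forall N \near \oo,
    `|mean (iota s N) (fun n => U (zpoly c D.+1 n) f)| <= 4 * tau.
Proof.
move=> tau0 finv nf; pose x n := U (zpoly c D.+1 n) f.
have [a a0 fa] := null_almost_invariant_multiples (isT : 1 < D.+2)%N tau0 finv nf.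
have qa0 : [seq (q * m)%N | m <- a] != [::] by rewrite -size_eq0 size_map size_eq0.
have xf n : `|x n| <= `|f| by rewrite (norm_act isoU).
apply: filterS (near_mean_shift_mean s xf qa0 tau0) => N; rewrite mean_map.
set shifted := mean a _ => shiftN.
pose linear_shift n m := U (zpoly c D.+1 n + c 1%N *+ (q * m)) f.
pose linear := mean a (fun m => mean (iota s N) (linear_shift^~ m)).
have linearN : `|shifted - linear| <= tau.
  rewrite -meanB; apply: norm_mean_le => [|m _]; first exact: ltW.
  rewrite /= mean_iotaD -meanB; apply: norm_mean_le => [|n _]; first exact: ltW.
  by rewrite norm_act_sub opprD addrA finv ?zpoly_shift.
have boundN : `|linear| <= 2 * tau.
  rewrite /linear mean_exchange; apply: norm_mean_le => [|n _].
    by rewrite mulr_ge0// ltW.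
  have -> : mean a (linear_shift n) =
      U (zpoly c D.+1 n) (mean a (fun m => U (c 1%N *+ q *+ m) f)).
    by rewrite linear_mean; apply: eq_mean => m /=; rewrite -(actD isoU) -mulrnA.
  by rewrite (norm_act isoU).
have := lerB_dist (mean (iota s N) x) shifted.
by have := lerB_dist shifted linear; lra.
Qed.

End AlmostInvariant.

Section PolynomialMeanErgodic.
Variable R : realType.

Definition small_zpoly_means (D q : nat) (C eps : R) : Prop :=
  forall (V : preHilbertType R) (G : zmodType) (U : G -> {linear V -> V}),
    isometric_action U -> forall (c : nat -> G) (f : V), `|f| <= C ->
    null U (zspan 1 D.+1 (fun j => c j *+ q)) f -> forall s,
  \forall N \near \oo, `|mean (iota s N) (fun n => U (zpoly c D n) f)| <= eps.

Lemma small_zpoly_means0 q (C eps : R) : 0 <= eps -> small_zpoly_means 0 q C eps.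
Proof.
move=> eps0 V G U isoU c f _ nf s; near=> N.
have f0 : `|f| = 0.
  apply: null_trivial isoU _ _ _ nf => v /asboolP[k ->]; exact: big_geq.
by apply: norm_mean_le => // n _; rewrite (norm_act isoU) f0.
Unshelve. all: by end_near. Qed.

(* The differences [p (n + k) - p (n + h)] have degree [D]. *)
Lemma near_mean_zpoly_null_higher D q (C eta : R) (H M : nat) :
  (forall j k, (2 <= j < D.+2)%N -> (0 < k < H)%N -> (j * k %| M)%N) ->
  (0 < H)%N -> 0 <= eta -> small_zpoly_means D q C eta ->
  forall (V : preHilbertType R) (G : zmodType) (U : G -> {linear V -> V}),
    isometric_action U -> forall (c : nat -> G) (f : V), `|f| <= C ->
    null U (zspan 2 D.+2 (fun j => c j *+ (q * M ^ D))) f ->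
  forall s (tau : R), 0 < tau -> \forall N \near \oo,
    `|mean (iota s N) (fun n => U (zpoly c D.+1 n) f)| <=
      Num.sqrt (C ^+ 2 / H%:R + eta * C) + tau.
Proof.
move=> jkM H0 eta0 IH V G U isoU c f fC nf s tau tau0.
have C0 : 0 <= C by rewrite (le_trans _ fC).
apply: van_der_corput => // [|n|h k /andP[hk kH]]; first exact: mulr_ge0.
  by rewrite (norm_act isoU).
have khM j : (2 <= j < D.+2)%N -> (j * (k - h) %| M)%N.
  by move=> jD; apply: jkM => //; lia.
have ndiff := null_sub (@zspan_diff_coef _ q c _ _ _ khM) nf.
apply: filterS (IH _ _ _ isoU _ _ fC ndiff (s + h)%N) => N.
rewrite mean_iotaD; set z := mean _ _ => zN.
have -> : mean (iota s N) (fun n => dot (U (zpoly c D.+1 (n + k)) f)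
    (U (zpoly c D.+1 (n + h)) f) : R^o) = dot z f.
  rewrite dot_meanl; apply: eq_mean => n.
  by rewrite -{1}(subnKC (ltnW hk)) addnA zpoly_diff (actD isoU) (dot_act isoU).
by rewrite (le_trans (cauchy_schwarz _ _))// ler_pM.
Qed.

Lemma small_zpoly_meansS D q (C eta tau : R) (H M : nat) :
  (forall j k, (2 <= j < D.+2)%N -> (0 < k < H)%N -> (j * k %| M)%N) ->
  (0 < H)%N -> 0 <= eta -> 0 < tau -> small_zpoly_means D q (2 * C) eta ->
  small_zpoly_means D.+1 (q * M ^ D) C
    (Num.sqrt ((2 * C) ^+ 2 / H%:R + eta * (2 * C)) + 5 * tau).
Proof.
move=> jkM H0 eta0 tau0 small_q V G U isoU c f fC nf s.
pose L := zspan 2 D.+2 (fun j => c j *+ (q * M ^ D)).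
have [t tL t_inv] := almost_invariant_orbit_mean isoU (L : zmodClosed G) f tau0.
pose f' := orbit_mean U t f.
have ff' : `|f - f'| <= 2 * C.
  by rewrite (le_trans (norm_sub_orbit_mean isoU _ _))// ler_pM2l.
have near_diff := near_mean_zpoly_null_higher jkM H0 eta0 small_q isoU ff'
  (null_sub_orbit_mean isoU f tL) s tau0.
have near_inv := near_mean_zpoly_almost_invariant isoU s tau0 t_inv
  (null_orbit_mean isoU t nf).
apply: filterS2 near_diff near_inv => N diffN invN.
by rewrite (le_trans (norm_mean_act_split U _ _ f f'))//; lra.
Qed.

Theorem polynomial_mean_ergodic D (C eps : R) : 0 < C -> 0 < eps ->
  exists2 q, (0 < q)%N & small_zpoly_means D q C eps.
Proof.
elim: D C eps => [|D IH] C eps C0 eps0.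
  by exists 1%N => //; exact/small_zpoly_means0/ltW.
pose e := eps / 6; have e0 : 0 < e by rewrite divr_gt0.
have C20 : 0 < 2 * C by rewrite mulr_gt0.
have e20 : 0 < e ^+ 2 / 2 by rewrite divr_gt0// exprn_gt0.
have eta0 := divr_gt0 e20 C20; have [q q0 small_q] := IH _ _ C20 eta0.
pose H := (Num.truncn ((2 * C) ^+ 2 / (e ^+ 2 / 2))).+1.
have jkM j k : (2 <= j < D.+2)%N -> (0 < k < H)%N -> (j * k %| D.+1`! * H`!)%N.
  by move=> jD kH; apply: dvdn_mul; apply: dvdn_fact; lia.
exists (q * (D.+1`! * H`!) ^ D)%N.
  by rewrite muln_gt0 q0 expn_gt0 muln_gt0 !fact_gt0.
have sqrt_le : Num.sqrt ((2 * C) ^+ 2 / H%:R + e ^+ 2 / 2 / (2 * C) * (2 * C)) <= e.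
  rewrite -[leRHS](ger0_norm (ltW e0)) -sqrtr_sqr ler_wsqrtr//.
  rewrite [leRHS]splitr divfK ?gt_eqF// lerD2r.
  by rewrite ler_pdivrMr// -ler_pdivrMl// mulrC ltW// truncnS_gt.
have small_qS := small_zpoly_meansS jkM isT (ltW eta0) e0 small_q.
move=> V G U isoU c f fC nf s; have := small_qS V G U isoU c f fC nf s.
by apply: filterS => N; move: sqrt_le; rewrite /e; lra.
Qed.

End PolynomialMeanErgodic.

(** * Multiplicative complexity *)

Section MultiplicativeComplexity.
Variables (D r : nat).

Definition coef_row (P : 'I_r -> {poly int}) (j : nat) : 'rV[int]_r :=
  \row_i (P i)`_j.

Definition coef_mx (P : 'I_r -> {poly int}) : 'M[int]_(r, D) :=
  \matrix_(i, j) (P i)`_j.+1.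

Definition primitive_divisors_le (Q : nat) (C : 'M[int]_(r, D)) : Prop :=
  forall a : 'rV[int]_r, gcd_family (a 0) = 1%N ->
  forall m : int, (forall j, (m %| (a *m C) 0%R j)%Z) -> (`|m| <= Q)%N.

Lemma polymap_zpoly (P : 'I_r -> {poly int}) (n : nat) :
  (forall i, (size (P i) <= D.+1)%N) -> polymap P n%:Z = zpoly (coef_row P) D n.
Proof.
move=> PD; apply/rowP => i; rewrite mxE (horner_coef_wide _ (PD i)) /zpoly big_mkord.
by rewrite summxE; apply: eq_bigr => j _; rewrite mulmxnE mxE -mulr_natr natrX natz.
Qed.

Lemma dvdn_gcd_family (I : finType) (a : I -> int) i : (gcd_family a %| `|a i|)%N.
Proof. by rewrite /gcd_family (bigD1 i)//= dvdn_gcdl. Qed.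

Lemma gcd_family_unitmx n (A : 'M[int]_n) i : A \in unitmx -> gcd_family (A i) = 1%N.
Proof.
move=> uA; suff : ((gcd_family (A i))%:Z %| 1)%Z by rewrite dvdzE/= dvdn1 => /eqP.
have -> : 1%:Z = \sum_k A i k * invmx A k i.
  by have := mulmxV uA => /matrixP/(_ i i); rewrite !mxE eqxx => ->.
by apply: rpred_sum => k _; rewrite dvdz_mulr// dvdzE dvdn_gcd_family.
Qed.

Lemma mult_complexity_primitive_divisors (P : 'I_r -> {poly int}) Q :
  mult_complexity D P Q -> primitive_divisors_le Q (coef_mx P).
Proof.
move=> PQ a pa m mC; have := PQ (a 0) m; rewrite pa gcd1n => /(_ erefl)/=.
have [->//|m0] := eqVneq m 0; rewrite (gcdn_idPr _)//.
rewrite big_nat; elim/big_ind : _ => [||j /andP[j0 jD]]; first exact: dvdn0.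
  by move=> x y mx my; rewrite dvdn_gcd mx.
have jD' : (j.-1 < D)%N by lia.
have := mC (Ordinal jD'); rewrite dvdzE mxE coef_sum; congr (_ %| `|_|)%N.
apply: eq_bigr => i _.
by rewrite mxE/= prednK// coefZ coefB coefC gtn_eqF// subr0.
Qed.

Lemma diag_mx_solve Q (A : 'M[int]_(r, D)) (v : 'cV[int]_r) : is_diag_mx A ->
  (forall i m, (forall j, (m %| A i j)%Z) -> (`|m| <= Q)%N) ->
  exists u, A *m u = Q`!%:Z *: v.
Proof.
move=> /is_diag_mxP Adiag AQ.
have /choice[e eP] (i : 'I_r) : exists j : 'I_D, i = j :> nat /\ A i j != 0.
  apply: contrapT => /forallNP Ai0.
  suff /AQ : forall j, (Q.+1%:Z %| A i j)%Z by rewrite /= ltnn.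
  move=> j.
  have [ij|/Adiag ->] := eqVneq (i : nat) j; last exact: dvdz0.
  by have [->|Aij] := eqVneq (A i j) 0; [exact: dvdz0|case: (Ai0 j)].
have Ae0 i j : j != e i -> A i j = 0.
  by move=> je; apply: Adiag; rewrite (eP i).1 eq_sym.
have AeQ i : (A i (e i) %| Q`!%:Z)%Z.
  rewrite dvdzE/= dvdn_fact// absz_gt0 (eP i).2 (AQ i)// => j.
  by have [->|/Ae0 ->] := eqVneq j (e i); [exact: dvdzz|exact: dvdz0].
exists (\col_j oapp (fun i => (Q`!%:Z %/ A i (e i))%Z * v i 0) 0 (insub (j : nat))).
apply/colP => i; rewrite !mxE (bigD1 (e i))//= big1; last first.
  by move=> j /Ae0 ->; rewrite mul0r.
by rewrite mxE -(eP i).1 valK/= addr0 mulrA [A _ _ * _]mulrC divzK.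
Qed.

Lemma primitive_divisors_le_solve Q (C : 'M[int]_(r, D)) (v : 'cV[int]_r) :
  primitive_divisors_le Q C -> exists u, C *m u = Q`!%:Z *: v.
Proof.
have [L uL [S uS [d _ ->]]] := int_Smith_normal_form C; set A := \matrix_(_, _) _ => CQ.
have Adiag : is_diag_mx A.
  by apply/is_diag_mxP => i j /negPf ij; rewrite mxE ij mulr0n.
have AQ i m : (forall j, (m %| A i j)%Z) -> (`|m| <= Q)%N.
  move=> mA; apply: (CQ (row i (invmx L))) => [|j].
    have uLi : invmx L \in unitmx by rewrite unitmx_inv.
    rewrite -[RHS](gcd_family_unitmx i uLi).
    by congr gcd_family; apply/funext => k; rewrite mxE.
  rewrite -row_mul !mulmxA mulVmx// mul1mx !mxE.
  by apply: rpred_sum => k _; rewrite dvdz_mulr.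
have [u Au] := diag_mx_solve (invmx L *m v) Adiag AQ.
exists (invmx S *m u); rewrite -!mulmxA (mulmxA S) mulmxV// mul1mx Au.
by rewrite -scalemxAr mulmxA mulmxV// mul1mx.
Qed.

Lemma mult_complexity_zspan Q q (P : 'I_r -> {poly int}) (v : 'rV[int]_r) :
  mult_complexity D P Q ->
  v *+ (q * Q`!) \in zspan 1 D.+1 (fun j => coef_row P j *+ q).
Proof.
move=> /mult_complexity_primitive_divisors PQ.
have [u Pu] := primitive_divisors_le_solve v^T PQ.
have -> : v *+ (q * Q`!) = \sum_(j < D) coef_row P j.+1 *+ q *~ u j 0.
  apply/rowP => i; have /colP/(_ i) := Pu; rewrite !mxE summxE => Pui.
  rewrite mulmxnE mulnC mulrnA -[v 0 i *+ _]mulr_natl natz -Pui -sumrMnl.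
  apply: eq_bigr => j _; rewrite -scaler_int !mxE mulmxnE mxE intz.
  by rewrite mulrnAr mulrC.
rewrite rpred_sum// => j _; rewrite rpredMz//.
by apply: (mem_zspan (fun j => coef_row P j *+ q)); rewrite /= ltnS.
Qed.

End MultiplicativeComplexity.

(** * The Koopman representation *)

Section SquareIntegrable.
Context d (X : measurableType d) (R : realType) (mu : {measure set X -> \bar R}).
Local Notation L2 := (LfunType mu (lee1n 2)).
Implicit Types f g h : L2.

Lemma integrable_L2M f g : mu.-integrable setT (EFin \o (fun x => f x * g x)).
Proof. by apply/Lfun1_integrable/Lfun2_mul_Lfun1; exact: LfunP. Qed.

Definition L2dot f g : R := \int[mu]_x (f x * g x).

Fact L2dotC f g : L2dot f g = L2dot g f.
Proof. by apply: eq_Rintegral => x _; rewrite mulrC. Qed.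

Fact L2dot_scalar h : scalar (L2dot^~ h).
Proof.
move=> a f g; rewrite /L2dot; under eq_Rintegral do rewrite mulrDl.
rewrite RintegralD//; [|exact: (integrable_L2M (a *: f))|exact: integrable_L2M].
rewrite -RintegralZl//; last exact: integrable_L2M.
by congr (_ + _); apply: eq_Rintegral => x _; rewrite mulrA.
Qed.

Fact L2dot_ge0 f : 0 <= L2dot f f.
Proof. by apply: Rintegral_ge0 => x _; rewrite -expr2 sqr_ge0. Qed.

HB.instance Definition _ :=
  isPreHilbert.Build R L2 L2dotC L2dot_scalar L2dot_ge0.
(* The generic instance on [PreHilbert.sort] is not found at the concrete type. *)
HB.instance Definition _ := Num.Zmodule_isSemiNormed.Build R L2
  (@hnormD R L2) (@hnormMn R L2) (@hnormN R L2).

Lemma Lnorm_L2 f : Lnorm mu 2%:E (EFin \o f) = `|f|%:E.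
Proof.
have ffE : (\int[mu]_x `|(EFin \o f) x| `^ 2 = (dot f f)%:E)%E.
  rewrite fineK; last by apply: integrable_fin_num => //; exact: integrable_L2M.
  by apply: eq_integral => x _ /=; rewrite powR_mulrn// real_normK ?num_real// expr2.
by rewrite unlock ffE poweR_EFin powR12_sqrt ?dot_ge0.
Qed.

Lemma L2_sumE (I : Type) (s : seq I) (F : I -> L2) x :
  (\sum_(i <- s) F i : L2) x = \sum_(i <- s) F i x.
Proof. by elim/big_rec2 : _ => // i y g _ <-. Qed.

Lemma L2_meanE (I : Type) (s : seq I) (F : I -> L2) x :
  mean s F x = mean s (fun i => F i x : R^o).
Proof. by rewrite /mean -[LHS]/(_ * (\sum_(i <- s) F i : L2) x) L2_sumE. Qed.

Lemma Rintegral_indic (D A : set X) : measurable D -> measurable A ->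
  \int[mu]_(x in D) \1_A x = fine (mu (A `&` D)) :> R.
Proof. by move=> mD mA; rewrite /Rintegral integral_indic. Qed.

End SquareIntegrable.

Section FiniteMeasureL2.
Context d (X : measurableType d) (R : realType).
Variable mu : {finite_measure set X -> \bar R}.
Local Notation L2 := (LfunType mu (lee1n 2)).

Definition L2cst (a : R) : L2 := Lfun_Sub _ (Lfun_cst mu a 2).

Lemma Lfun_indic (p : R) (A : set X) : p != 0 -> measurable A ->
  (\1_A : X -> R) \in Lfun mu p%:E.
Proof.
move=> p0 mA; apply/andP; split; rewrite inE/=; first exact: measurable_indic.
rewrite /finite_norm unlock poweR_lty//.
have indicE_powR x : (`|(\1_A x)%:E| `^ p = (\1_A x)%:E :> \bar R)%E.
  by rewrite /= indicE; case: (x \in A); rewrite ?normr1 ?normr0 ?powR1 ?powR0.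
under eq_integral do rewrite indicE_powR.
by rewrite integral_indic// setIT ltey_eq fin_num_measure.
Qed.

Definition L2indic (A : set X) (mA : measurable A) : L2 :=
  Lfun_Sub _ (Lfun_indic (lt0r_neq0 (ltr0Sn R 1)) mA).

Lemma L2_integrable (f : L2) : mu.-integrable setT (EFin \o f).
Proof.
apply/Lfun1_integrable; apply: (Lfun_subset12 _ (LfunP f)).
exact: fin_num_measure.
Qed.

Lemma dot_L2cst (f : L2) a : dot f (L2cst a) = (\int[mu]_x f x) * a.
Proof. by rewrite -RintegralZr//; exact: L2_integrable. Qed.

Lemma norm_L2cst_sqr a : `|L2cst a| ^+ 2 = a ^+ 2 * fine (mu setT).
Proof. by rewrite normr_sqr dot_L2cst Rintegral_cst// mulrAC. Qed.

Lemma norm_L2indic_sqr (A : set X) (mA : measurable A) :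
  `|L2indic mA| ^+ 2 = fine (mu A).
Proof.
rewrite normr_sqr -[A in RHS]setIT -Rintegral_indic//; apply: eq_Rintegral => x _ /=.
by rewrite !indicE; case: (x \in A); rewrite ?mulr1 ?mulr0.
Qed.

End FiniteMeasureL2.

Lemma norm_L2indic_le1 d (X : measurableType d) (R : realType) (mu : probability X R)
    (A : set X) (mA : measurable A) :
  `|L2indic mu mA| <= 1.
Proof.
rewrite -(@expr_le1 _ 2)// norm_L2indic_sqr -lee_fin fineK ?fin_num_measure//.
exact: probability_le1.
Qed.

Section Koopman.
Context d (X : measurableType d) (R : realType) (mu : {measure set X -> \bar R}).
Local Notation L2 := (LfunType mu (lee1n 2)).

Definition measure_preserving (S : X -> X) : Prop :=
  measurable_fun setT S /\ forall A, measurable A -> mu (S @^-1` A) = mu A.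

Lemma ge0_integral_preserving S (h : X -> \bar R) : measure_preserving S ->
  measurable_fun setT h -> (forall x, 0 <= h x)%E ->
  (\int[mu]_x h (S x) = \int[mu]_x h x)%E.
Proof.
move=> [mS muS] mh h0.
rewrite -[setT in LHS](preimage_setT S) -(ge0_integral_pushforward mS)//.
by apply: eq_measure_integral => A mA _; exact: muS.
Qed.

Lemma Lnorm_comp_preserving S (f : X -> R) (p : R) : measure_preserving S ->
  measurable_fun setT f ->
  Lnorm mu p%:E (EFin \o (f \o S)) = Lnorm mu p%:E (EFin \o f).
Proof.
move=> pS mf; rewrite unlock.
rewrite (ge0_integral_preserving (h := fun x => (`|(f x)%:E| `^ p)%E)) //.
  apply: (measurableT_comp (measurable_poweR p)).
  exact/measurableT_comp/measurable_EFinP.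
by move=> x; exact: poweR_ge0.
Qed.

Lemma Lfun_comp_preserving S (f : X -> R) (p : R) : measure_preserving S ->
  f \in Lfun mu p%:E -> f \o S \in Lfun mu p%:E.
Proof.
move=> pS /andP[/[!inE]/= mf ff]; apply/andP; split; rewrite inE/=.
  exact: measurableT_comp mf pS.1.
by rewrite /finite_norm Lnorm_comp_preserving.
Qed.

Definition koopman S (pS : measure_preserving S) (f : L2) : L2 :=
  Lfun_Sub _ (Lfun_comp_preserving pS (LfunP f)).

Fact koopman_linear S (pS : measure_preserving S) : linear (koopman pS).
Proof. by move=> a f g; apply/LfuneqP. Qed.

HB.instance Definition _ S (pS : measure_preserving S) :=
  GRing.isLinear.Build R L2 L2 *:%R (koopman pS) (koopman_linear pS).

Lemma norm_koopman S (pS : measure_preserving S) f : `|koopman pS f| = `|f|.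
Proof. by apply: EFin_inj; rewrite -!Lnorm_L2 Lnorm_comp_preserving. Qed.

Variables (r : nat) (T : 'rV[int]_r -> X -> X).
Hypothesis muT : mp_action mu T.

Lemma action_preserving v : measure_preserving (T v).
Proof. by have [_ _ mT Tmu] := muT; split; [exact: mT|exact: Tmu]. Qed.

Definition koopman_action v : {linear L2 -> L2} := koopman (action_preserving v).

Lemma koopman_action_isometric : isometric_action koopman_action.
Proof.
have [T0 TD _ _] := muT; split=> [f|u v f|u f].
- by apply/LfuneqP => x /=; rewrite T0.
- by apply/LfuneqP => x /=; rewrite addrC TD.
- exact: norm_koopman.
Qed.

End Koopman.

(** * Equidistribution *)

Section BoundedFunctions.
Import numFieldNormedType.Exports.
Context d (X : measurableType d) (R : realType).
Variable mu : {finite_measure set X -> \bar R}.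

Lemma integrable_bounded (g : X -> R) (M : R) : measurable_fun setT g ->
  (forall x, `|g x| <= M) -> mu.-integrable setT (EFin \o g).
Proof.
move=> mg gM; apply: measurable_bounded_integrable => //.
  by rewrite ltey_eq fin_num_measure.
by exists M; split => [|K MK x _ /=]; [exact: num_real|rewrite (le_trans (gM x))// ltW].
Qed.

Lemma Rintegral_excess_cvg0 (F : nat -> X -> R) (c M : R) :
  (forall n, measurable_fun setT (F n)) -> (forall n x, `|F n x| <= M) ->
  {ae mu, forall x, exists2 L : R, F n x @[n --> \oo] --> L & L <= c} ->
  \int[mu]_x Num.max (F n x - c) 0 @[n --> \oo] --> 0.
Proof.
move=> mF FM Fcvg; pose h n x := Num.max (F n x - c) 0.
have mh n : measurable_fun setT (h n).
  by apply: measurable_maxr => //; exact: measurable_funB.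
have hM n x : `|h n x| <= M + `|c|.
  have M0 : 0 <= M := le_trans (normr_ge0 _) (FM n x).
  rewrite ger0_norm ?le_max ?lexx ?orbT// ge_max addr_ge0// andbT.
  by rewrite (le_trans (ler_norm _))// (le_trans (ler_normB _ _))// lerD2r.
have h_cvg0 : {ae mu, forall x, setT x ->
    (EFin \o h n) x @[n --> \oo] --> (cst 0%E x : \bar R)}.
  apply: filterS Fcvg => x [L FL Lc] _; apply: cvg_EFin; first by near=> n.
  apply/cvgrPdist_le => e e0; move/cvgrPdist_le : FL => /(_ _ e0).
  apply: filterS => n; rewrite ler_norml => /andP[Fn _].
  rewrite sub0r normrN /= ger0_norm ?le_max ?lexx ?orbT// ge_max (ltW e0) andbT.
  by move: Fn Lc; lra.
have icst : mu.-integrable setT (cst (M + `|c|)%:E : X -> \bar R).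
  exact: finite_measure_integrable_cst.
have h_le : {ae mu, forall x n, setT x ->
    (`|(EFin \o h n) x| <= cst (M + `|c|)%:E x)%E}.
  by apply: aeW => x n _; rewrite /= lee_fin.
have mhE n : measurable_fun setT (EFin \o h n) by exact/measurable_EFinP.
have [_ _] := dominated_convergence measurableT mhE (measurable_cst _) h_cvg0 icst h_le.
by rewrite integral0 => /fine_cvgP[].
Unshelve. all: by end_near. Qed.

Lemma Rintegral_sqr_le (g : X -> R) (c : R) :
  measurable_fun setT g -> (forall x, 0 <= g x <= 1) -> 0 <= c ->
  \int[mu]_x (g x ^+ 2) <= c * \int[mu]_x g x + \int[mu]_x Num.max (g x - c) 0.
Proof.
move=> mg g01 c0; have g_le1 x : `|g x| <= 1.
  by have /andP[g0 g1] := g01 x; rewrite ger0_norm.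
have ig := integrable_bounded mg g_le1.
have im : mu.-integrable setT (EFin \o (fun x => Num.max (g x - c) 0)).
  apply: (@integrable_bounded _ (1 + c)).
    by apply: measurable_maxr => //; exact: measurable_funB.
  move=> x; have /andP[g0 g1] := g01 x.
  by rewrite ger0_norm ?le_max ?lexx ?orbT// ge_max; lra.
have icg : mu.-integrable setT (EFin \o (fun x => c * g x)).
  by apply: eq_integrable (integrableZl measurableT c ig).
rewrite -RintegralZl// -RintegralD//; apply: le_Rintegral => //.
- apply: (@integrable_bounded _ 1) => [|x]; first exact: measurable_funX.
  by rewrite normrX expr_le1.
- exact: eq_integrable (integrableD measurableT icg im).
- move=> x _; have /andP[g0 g1] := g01 x.
  have : g x - c <= Num.max (g x - c) 0 by rewrite le_max lexx.
  have : 0 <= Num.max (g x - c) 0 by rewrite le_max lexx orbT.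
  by nra.
Qed.

End BoundedFunctions.

Section Equidistribution.
Import numFieldNormedType.Exports.
Context d (X : measurableType d) (R : realType) (mu : probability X R).
Variables (r : nat) (T : 'rV[int]_r -> X -> X).
Hypothesis muT : mp_action mu T.
Local Notation U := (koopman_action muT).

Definition box (q n : nat) : seq 'rV[int]_r :=
  [seq \row_i ((q * (a i).+1)%N%:Z) | a : {ffun 'I_r -> 'I_n}].

Lemma size_box q n : size (box q n) = (n ^ r)%N.
Proof. by rewrite size_map -cardE card_ffun !card_ord. Qed.

Lemma box_neq_nil q n : (0 < n)%N -> box q n != [::].
Proof. by move=> n0; rewrite -size_eq0 size_box -lt0n expn_gt0 n0. Qed.

Lemma freq_box q B (mB : measurable B) x n :
  @freq d X R r T q B x n = orbit_mean U (box q n) (L2indic mu mB) x.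
Proof.
rewrite L2_meanE /mean size_box natrX big_map/= big_enum_cond.
by rewrite /freq; congr (_ * _); apply: eq_bigl => a; rewrite inE.
Qed.

Lemma Rintegral_orbit_mean s f : s != [::] ->
  \int[mu]_x orbit_mean U s f x = \int[mu]_x f x.
Proof.
move=> s0; rewrite -[LHS]mulr1 -[RHS]mulr1 -!dot_L2cst.
apply: (dot_orbit_mean_invariant (koopman_action_isometric muT)) => // v.
exact/LfuneqP.
Qed.

Lemma orbit_mean_ge0_le1 s (f : LfunType mu (lee1n 2)) : (forall x, 0 <= f x <= 1) ->
  forall x, 0 <= orbit_mean U s f x <= 1.
Proof.
move=> f01 x; rewrite L2_meanE; apply/andP; split.
  by rewrite mulr_ge0 ?invr_ge0 ?sumr_ge0// => v _; have /andP[] := f01 (T v x).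
by apply: mean_le => // v _; have /andP[] := f01 (T v x).
Qed.

Lemma near_norm_box_mean q (delta tau : R) B (mB : measurable B) :
  0 <= delta -> 0 < tau -> equidistributed mu T q delta B ->
  \forall n \near \oo, `|orbit_mean U (box q n) (L2indic mu mB)| ^+ 2 <=
    (1 + delta) * fine (mu B) ^+ 2 + tau.
Proof.
move=> delta0 tau0 eqB; pose m := fine (mu B); pose c := (1 + delta) * m.
have c0 : 0 <= c by rewrite mulr_ge0 ?addr_ge0 ?fine_ge0.
pose F n : LfunType mu (lee1n 2) := orbit_mean U (box q n) (L2indic mu mB).
have F01 n x : 0 <= F n x <= 1.
  by apply: orbit_mean_ge0_le1 => y; rewrite /= indicE ler0n lern1 leq_b1.
have Fcvg : {ae mu, forall x, exists2 L : R, F n x @[n --> \oo] --> L & L <= c}.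
  move: eqB; rewrite /equidistributed; apply: filterS => x [L [FL Lc]]; exists L.
    by under eq_cvg do rewrite -freq_box.
  by rewrite -lee_fin EFinM fineK// fin_num_measure.
have F_le1 n x : `|F n x| <= 1 by have /andP[F0 F1] := F01 n x; rewrite ger0_norm.
have mF n : measurable_fun setT (F n) by exact: measurable_funPT.
have /cvgrPdist_le/(_ _ tau0) excess := Rintegral_excess_cvg0 mF F_le1 Fcvg.
near=> n.
have n0 : (0 < n)%N by near: n; exists 1%N.
have sqrE : `|F n| ^+ 2 = \int[mu]_x (F n x ^+ 2).
  by rewrite normr_sqr; apply: eq_Rintegral => x _; rewrite expr2.
rewrite sqrE (le_trans (Rintegral_sqr_le _ (mF n) (F01 n) c0))//.
rewrite Rintegral_orbit_mean ?box_neq_nil//.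
rewrite Rintegral_indic// setIT /c -mulrA -expr2 lerD2l.
have : `|0 - \int[mu]_x Num.max (F n x - c) 0| <= tau by near: n.
by rewrite sub0r normrN; apply: le_trans; exact: ler_norm.
Unshelve. all: by end_near. Qed.

Lemma near_box_mean_cst q (delta : R) B (mB : measurable B) :
  0 < delta <= 1 -> equidistributed mu T q delta B ->
  \forall n \near \oo,
    `|orbit_mean U (box q n) (L2indic mu mB) - L2cst mu (fine (mu B))| <=
      Num.sqrt (3 * delta).
Proof.
move=> /andP[delta0 delta1] eqB; have delta20 : 0 < 2 * delta by rewrite mulr_gt0.
near=> n; have n0 : (0 < n)%N by near: n; exists 1%N.
have boxn : `|orbit_mean U (box q n) (L2indic mu mB)| ^+ 2 <=
    (1 + delta) * fine (mu B) ^+ 2 + 2 * delta.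
  by near: n; exact: near_norm_box_mean (ltW delta0) delta20 eqB.
have m2 : delta * fine (mu B) ^+ 2 <= delta.
  rewrite ler_piMr ?(ltW delta0)// expr_le1 ?fine_ge0//.
  by rewrite -lee_fin fineK ?fin_num_measure// probability_le1.
rewrite -[leLHS]ger0_norm// -sqrtr_sqr ler_wsqrtr// normrB_sqr.
rewrite dot_L2cst [X in _ + X <= _]norm_L2cst_sqr.
rewrite [X in _ + _ * fine X <= _](probability_setT mu) mulr1.
rewrite Rintegral_orbit_mean ?box_neq_nil// Rintegral_indic// setIT.
by move: boxn m2; rewrite mulrDl mul1r; lra.
Unshelve. all: by end_near. Qed.

End Equidistribution.

Lemma limn_esup_le_near (R : realType) (u : (\bar R)^nat) (l : \bar R) :
  (\forall n \near \oo, (u n <= l)%E) -> (limn_esup u <= l)%E.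
Proof.
move=> ul; apply: (@le_trans _ _ (ereal_sup (u @` [set n | (u n <= l)%E]))).
  by apply: ereal_inf_lbound; exists [set n | (u n <= l)%E].
by apply: ge_ereal_sup => _ [n /= un <-].
Qed.

Lemma ergavgE d (X : measurableType d) (R : realType) (mu : probability X R)
    (D r : nat) (T : 'rV[int]_r -> X -> X) (muT : mp_action mu T)
    (P : 'I_r -> {poly int}) (B : set X) (mB : measurable B) (N : nat) :
  (forall i, (size (P i) <= D.+1)%N) ->
  ergavg mu T P B N = (L2cst mu (fine (mu B)) - mean (iota 1 N) (fun n =>
    koopman_action muT (zpoly (coef_row P) D n) (L2indic mu mB))) :> (X -> R).
Proof.
move=> PD; apply/funext => x; rewrite /ergavg; set M := mean _ _.
rewrite -[RHS]/(_ - M x); congr (_ - _).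
rewrite L2_meanE /mean size_iota /index_iota subn1; congr (_ * _).
by apply: eq_bigr => n _; rewrite (polymap_zpoly _ PD).
Qed.

Lemma drawn_from_box D r Q q n (P : 'I_r -> {poly int}) :
  mult_complexity D P Q -> (0 < n)%N ->
  drawn_from (zspan 1 D.+1 (fun j => coef_row P j *+ q)) (box r (q * Q`!) n).
Proof.
move=> PQ n0; rewrite /drawn_from box_neq_nil//=; apply/allP => _ /mapP[a _ ->].
suff -> : \row_i ((q * Q`! * (a i).+1)%N%:Z) = (\row_i (a i).+1%:Z) *+ (q * Q`!).
  exact: mult_complexity_zspan.
by apply/rowP => i; rewrite mulmxnE !mxE PoszM -mulr_natl natz.
Qed.

Theorem theorem4p1 (R : realType) (D r Q : nat) (eps : R) :
  (0 < D)%N -> (0 < r)%N -> (0 < Q)%N -> 0 < eps ->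
  exists q : nat, (0 < q)%N /\
  forall (delta : R), 0 < delta <= 1 ->
  forall (P : 'I_r -> {poly int}),
    (forall i, (size (P i) <= D.+1)%N) ->
    mult_complexity D P Q ->
    hyperplane_fleeing R P ->
  forall (d : measure_display) (X : measurableType d) (mu : probability X R)
         (T : 'rV[int]_r -> X -> X) (B : set X),
    mp_action mu T -> ergodic_action mu T ->
    measurable B -> equidistributed mu T q delta B ->
    (limn_esup (fun N => Lnorm mu 2%:E (EFin \o ergavg mu T P B N))
       <= (Num.sqrt (3 * delta) + eps)%:E)%E.
Proof.
move=> _ _ _ eps0.
have [q q0 small_q] := polynomial_mean_ergodic D (ltr0Sn R 1) eps0.
exists (q * Q`!)%N; split; first by rewrite muln_gt0 q0 fact_gt0.
move=> delta delta01 P PD PQ _ d X mu T B muT _ mB eqB.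
have isoU := koopman_action_isometric muT; set U := koopman_action muT in isoU.
pose f := L2indic mu mB; pose m := L2cst mu (fine (mu B)).
have [n0 _ /(_ n0.+1 (leqnSn n0)) f'm] := near_box_mean_cst muT mB delta01 eqB.
pose f' := orbit_mean U (box r (q * Q`!) n0.+1) f; rewrite -/f' -/m in f'm.
have box_in := drawn_from_box q PQ (ltn0Sn n0).
have ff' : `|f - f'| <= 2.
  by rewrite (le_trans (norm_sub_orbit_mean isoU _ _))// ler_piMr// norm_L2indic_le1.
have near_ff' := small_q _ _ _ isoU _ _ ff' (null_sub_orbit_mean isoU f box_in) 1%N.
apply: limn_esup_le_near; near=> N; have N0 : iota 1 N != [::].
  by rewrite -size_eq0 size_iota -lt0n; near: N; exists 1%N.
rewrite (ergavgE muT mB N PD) Lnorm_L2 lee_fin -/f -/m -/U distrC.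
have mU v : U v m = m by exact/LfuneqP.
rewrite (le_trans (norm_mean_act_sub_invariant isoU _ _ f' N0 mU))// addrC lerD//.
by near: N.
Unshelve. all: by end_near. Qed.
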